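(* Let $\beta\in L^1(\mathbb{R})$ be such that $\beta'=\mu$ is a finite Borel measure on $\mathbb{R}$, with point values $\beta(x)=\int_{(-\infty,x]}d\mu$, and let $f:\mathbb{R}\to\mathbb{R}$ be locally Lipschitz with $f(0)=0$. Let $h>0$, $x_i=ih$ for $i\in\mathbb{Z}$, and $\bm{\beta}_h=(\beta(x_i))_{i\in\mathbb{Z}}$. Let $\mathbf{v}\in C^1([0,T],l^\infty)$ be the solution of $$\frac{d\mathbf{v}}{dt}=-D\big(\bm{\beta}_h\ast f(\mathbf{v})\big)$$ with initial value $\mathbf{v}(0)$, and for a positive integer $N$ let $$\delta=\sup\{|v_i(t)|: t\in[0,T],\ |i|>N\},\qquad \epsilon(\delta)=\max_{|z|\le\delta}|f(z)|.$$ Then for sufficiently small $\epsilon(\delta)$, the solution $\mathbf{v}^N=(v_i^N)_{-N\le i\le N}$ of the truncated system $$\frac{dv_i^N}{dt}=-\sum_{j=-N}^{N}h\,D\beta(x_i-x_j)\,f(v_j^N),\qquad -N\le i\le N,$$ with initial value $\mathbf{v}^N(0)=\mathcal{T}^N\mathbf{v}(0)$ exists for times $t\in[0,T]$ and $$|v_i^N(t)-v_i(t)|\le C\,\epsilon(\delta),\qquad t\in[0,T],$$ for all $-N\le i\le N$.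
   Context: $\mu$ is a signed measure and $\beta'$ is the distributional derivative. $l^\infty$ is the Banach space of bounded doubly infinite real sequences $\mathbf{w}=(w_i)_{i\in\mathbb{Z}}$ with the sup-norm. For sequences, $(\mathbf{w}\ast\mathbf{v})_i=\sum_{j\in\mathbb{Z}}h\,w_{i-j}v_j$, $(D\mathbf{w})_i=\frac{1}{2h}(w_{i+1}-w_{i-1})$, $f(\mathbf{v})=(f(v_i))_{i\in\mathbb{Z}}$. Also $D\beta(x_i-x_j)=(D\bm{\beta}_h)_{i-j}=\frac{1}{2h}\big(\beta(x_{i-j+1})-\beta(x_{i-j-1})\big)$. The truncation operator $\mathcal{T}^N:l^\infty\to\mathbb{R}^{2N+1}$ is $\mathcal{T}^N\mathbf{v}=(v_{-N},v_{-N+1},\ldots,v_0,\ldots,v_{N-1},v_N)$. ''For sufficiently small $\epsilon(\delta)$'' means: there is a threshold $\epsilon_0>0$, independent of $N$, such that the conclusion holds for every $N$ with $\epsilon(\delta)\le\epsilon_0$; $C$ is a constant independent of $N$, $i$ and $t$. *)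

(* Defs.v *)
From HB Require Import structures.
From mathcomp Require Import all_boot all_order all_algebra.
From mathcomp Require Import all_classical all_reals all_analysis.

Set Implicit Arguments.
Unset Strict Implicit.
Unset Printing Implicit Defensive.

Import Order.TTheory GRing.Theory Num.Theory.
Import numFieldNormedType.Exports.

Local Open Scope classical_set_scope.
Local Open Scope ring_scope.

Definition bounded_seq (R : realType) : {pred int -> R^o} :=
  [pred w : int -> R^o | `[< bounded_fun w >]].

Record linf (R : realType) := Linf {
  linf_seq :> int -> R^o;
  linf_bounded : bounded_seq linf_seq }.

HB.instance Definition _ (R : realType) := [isSub for @linf_seq R].
HB.instance Definition _ (R : realType) := [Choice of linf R by <:].

Section linf_normed.
Variable R : realType.

Lemma bounded_seqP (w : int -> R^o) :
  reflect (exists M, forall i, `|w i| <= M) (w \in @bounded_seq R).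
Proof.
apply: (iffP (asboolP _)) => [[M [_ wM]]|[M wM]].
  by exists (M + 1) => i; apply: (wM (M + 1)) => //; rewrite ltrDl.
exists M; split; first exact: num_real.
by move=> x Mx i _; exact: le_trans (wM i) (ltW Mx).
Qed.

Lemma bounded_seq_submod : submod_closed (@bounded_seq R).
Proof.
split=> [|a u v /bounded_seqP[M uM] /bounded_seqP[M' vM']].
  by apply/bounded_seqP; exists 0 => i; rewrite normr0.
apply/bounded_seqP; exists (`|a| * M + M') => i.
apply: le_trans (ler_normD _ _) _; rewrite lerD//.
by rewrite normrM ler_wpM2l.
Qed.

HB.instance Definition _ :=
  GRing.isSubmodClosed.Build R (int -> R^o) (@bounded_seq R) bounded_seq_submod.
HB.instance Definition _ := [SubChoice_isSubLmodule of linf R by <:].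

Definition linf_norm (w : linf R) : R := sup (range (fun i => `|w i|)).

Lemma linf_norm_ub (w : linf R) i : `|w i| <= linf_norm w.
Proof.
apply: ub_le_sup; last by exists i.
by have /bounded_seqP[M wM] := linf_bounded w; exists M => _ [j _ <-].
Qed.

Lemma linf_norm_le (w : linf R) M : (forall i, `|w i| <= M) -> linf_norm w <= M.
Proof. by move=> wM; apply: ge_sup; [exists `|w 0|, 0|move=> _ [i _ <-]]. Qed.

Lemma ler_linf_normD (u v : linf R) :
  linf_norm (u + v) <= linf_norm u + linf_norm v.
Proof.
apply: linf_norm_le => i.
by rewrite (le_trans (ler_normD _ _))// lerD// linf_norm_ub.
Qed.

Lemma linf_normZ (a : R) (w : linf R) : linf_norm (a *: w) = `|a| * linf_norm w.
Proof.
have le_norm b u : linf_norm (b *: u) <= `|b| * linf_norm u.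
  by apply: linf_norm_le => i; rewrite normrM ler_wpM2l// linf_norm_ub.
apply/le_anti; rewrite le_norm/=.
have [->|a0] := eqVneq a 0.
  by rewrite normr0 mul0r (le_trans _ (linf_norm_ub _ 0)).
rewrite mulrC -ler_pdivlMr ?normr_gt0// mulrC -normfV.
by rewrite -{1}[w](scalerK a0) le_norm.
Qed.

Lemma linf_norm0_eq0 (w : linf R) : linf_norm w = 0 -> w = 0.
Proof.
move=> w0; apply/val_inj/funext => i; apply/normr0_eq0/le_anti.
by rewrite normr_ge0 -w0 linf_norm_ub.
Qed.

HB.instance Definition _ := Lmodule_isNormed.Build R (linf R)
  ler_linf_normD linf_normZ linf_norm0_eq0.

Lemma linf_normE (w : linf R) : `|w| = sup (range (fun i => `|w i|)).
Proof. by []. Qed.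

End linf_normed.

(* The library's derivative is two-sided; at the endpoints of an interval
   these are the one-sided derivatives. *)
Section derive_on.
Context {R : realType} {V : normedModType R}.
Implicit Types (A : set R) (g : R -> V) (t : R).

Definition derivable_on A g t :=
  cvg ((s - t)^-1 *: (g s - g t) @[s --> within A t^']).

Definition derive_on A g t : V :=
  lim ((s - t)^-1 *: (g s - g t) @[s --> within A t^']).

Definition C1_on A g :=
  (forall t, A t -> derivable_on A g t) /\ {within A, continuous (derive_on A g)}.

End derive_on.

Definition locally_lipschitz (R : realType) (f : R -> R) :=
  forall x : R, exists2 U : set R, nbhs x U & [lipschitz f y | y in U].

Definition test_function (R : realType) (phi : R -> R) :=
  (forall n x, derivable (derive1n n phi) x 1) /\
  compact (closure [set x | phi x != 0]).

(* The integral against [mu] is the difference of the integrals against its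
   positive and negative parts, which do not depend on the choice of the Hahn
   decomposition. *)
Definition distributional_derivative (R : realType) (beta : R -> R)
    (mu : {charge set (measurableTypeR R) -> \bar R}) :=
  forall (P N : set (measurableTypeR R)) (PN : hahn_decomposition mu P N)
    (phi : R -> R), test_function phi ->
  (\int[@lebesgue_measure R]_x (beta x * derive1 phi x))%R =
  - ((\int[jordan_pos PN]_x phi x) - (\int[jordan_neg PN]_x phi x))%R.

Section lattice.
Context {R : realType}.
Implicit Types (beta f : R -> R) (h T : R) (a w z : int -> R) (v : R -> linf R).

(* Meaningful for absolutely summable families only; this covers all the sums
   below, since the grid values of an integrable function of bounded variation
   are summable and the other factor is bounded. *)
Definition zsum a : R :=
  fine ((\esum_(j in [set: int]) (EFin \o a)^\+ j) -
        (\esum_(j in [set: int]) (EFin \o a)^\- j))%E.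

Definition conv h w z : int -> R :=
  fun i => zsum (fun j => h * w (i - j) * z j).

Definition cdiff h w : int -> R :=
  fun i => (2 * h)^-1 * (w (i + 1) - w (i - 1)).

Definition grid_values h beta : int -> R := fun i => beta (i%:~R * h).

Definition lattice_solution h beta f T v :=
  C1_on `[0, T] v /\
  forall t, t \in `[0, T] -> forall i,
    derive_on `[0, T] v t i =
    - cdiff h (conv h (grid_values h beta) (f \o v t)) i.

Definition delta T v (N : nat) : R :=
  sup [set r | exists t (i : int),
    [/\ t \in `[0, T], (N%:Z < `|i|)%R & r = `|v t i|] ].

Definition epsilon f (d : R) : R :=
  sup [set `|f z| | z in [set z | `|z| <= d]].

(* Coordinate [k] of a vector in R^(2N+1) carries the index k - N. *)
Definition trunc_index (N : nat) (k : 'I_N.*2.+1) : int := k%:Z - N%:Z.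

Definition trunc (N : nat) w : 'rV[R]_N.*2.+1 := \row_k w (trunc_index k).

Definition trunc_rhs h beta f (N : nat) (u : 'rV[R]_N.*2.+1) : 'rV[R]_N.*2.+1 :=
  \row_k - \sum_(l < N.*2.+1)
    h * cdiff h (grid_values h beta) (trunc_index k - trunc_index l) * f (u 0 l).

Definition trunc_solution h beta f T (N : nat) (u0 : 'rV[R]_N.*2.+1)
    (u : R -> 'rV[R]_N.*2.+1) :=
  u 0 = u0 /\
  forall t, t \in `[0, T] ->
    derivable_on `[0, T] u t /\
    derive_on `[0, T] u t = trunc_rhs h beta f (u t).

End lattice.

(* Main.v *)
Require Import Defs.
From mathcomp Require Import all_boot all_order all_algebra.
From mathcomp Require Import all_classical all_reals all_analysis measurable_realfun.
From mathcomp Require Import ring lra zify.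

Set Implicit Arguments.
Unset Strict Implicit.
Unset Printing Implicit Defensive.

Import Order.TTheory GRing.Theory Num.Theory.
Import numFieldNormedType.Exports.

Local Open Scope classical_set_scope.
Local Open Scope ring_scope.

(** The infinite system and the truncated one have the same right-hand side up
    to the terms of index outside [-N, N], where [f (v_j)] is at most [eps] in
    absolute value. Hence everything rests on a bound, independent of [N], on the
    row sums of the kernel [h * D beta(x_i - x_j)], and on a Gronwall estimate in
    the sup-norm.

    The row sums are bounded by the sum [S] of the grid values of [|beta|]
    ([kernel_sum]), which is finite because [beta] is integrable and of bounded
    variation ([grid_values_summable]). With this bound the truncation of [v]
    satisfies the truncated system up to a defect [S * eps] ([trunc_defect]), and
    the truncated field is Lipschitz uniformly in [N] ([trunc_rhs_dist]). So any
    solution of the truncated system stays within [C * eps] of [v] as long as it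
    remains in a bounded region where [f] has a fixed Lipschitz constant.

    To avoid a continuation argument, [f] is first composed with the clamping of
    its argument to a segment that contains all values of [v] with a margin 1.
    The clamped system has a solution on all of [0, T] ([picard]), and the error
    estimate applies to it ([trunc_error]). When [C * eps <= 1] that solution
    remains within the margin, so it solves the original truncated system, and by
    [trunc_solution_unique] it is the only solution there is.

    Both [gronwall] and [picard] rest on one step ([bielecki_step]): in the norm
    weighted by [expR (- 2 * L * t)], integrating a derivative bounded by [L]
    times the norm halves that norm. *)

(** * Lipschitz bounds and differential inequalities *)

Lemma locally_lipschitz_nbhs (R : realType) (f : R -> R) x :
  locally_lipschitz f ->
  exists2 e : R, 0 < e & exists2 L : R, 0 <= L &
    forall y z, `|x - y| < e -> `|x - z| < e -> `|f y - f z| <= L * `|y - z|.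
Proof.
move=> /(_ x)[U /nbhs_ballP[e /= e0 eU]].
move=> /pinfty_ex_gt0[L L0 fL]; exists e => //; exists L; first exact: ltW.
by move=> y z xy xz; apply: (fL (y, z)); split; apply: eU.
Qed.

(** Compactness of the square rather than of the segment: near a diagonal point
    the local constant works, near any other point numerator and denominator of
    the difference quotient are bounded and bounded away from zero. The bounds
    on the quotient obtained near the points of the square then combine into
    one. *)
Lemma locally_lipschitz_segment (R : realType) (f : R -> R) (M : R) :
  locally_lipschitz f ->
  exists2 L : R, 0 < L &
    forall x y, `|x| <= M -> `|y| <= M -> `|f x - f y| <= L * `|x - y|.
Proof.
move=> fl.
have cK : compact (`[- M, M] `*` `[- M, M] : set (R * R)%type).
  by apply: compact_setX; exact: segment_compact.
have near2 (x y e e' : R) : 0 < e -> 0 < e' ->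
    \forall p \near (x, y), `|x - p.1| < e /\ `|y - p.2| < e'.
  move=> e0 e'0; exists (ball x e, ball y e') => [|[a b] []]//=.
  by split; exact: nbhsx_ballx.
have /compact_near_coveringP /(_ R +oo
  (fun L z => `|f z.1 - f z.2| <= L * `|z.1 - z.2|)) := cK.
move=> /(_ _)[].
  move=> [x y] _.
  have [e e0 [L L0 fL]] := locally_lipschitz_nbhs x fl.
  have [<-|xy] := eqVneq x y.
    near=> p L' => /=.
    have [px py] : `|x - p.1| < e /\ `|x - p.2| < e by near: p; exact: near2.
    apply: (le_trans (fL _ _ px py)).
    by apply: ler_wpM2r => //; near: L'; exact: nbhs_pinfty_ge.
  have [e' e'0 [L' L'0 fL']] := locally_lipschitz_nbhs y fl.
  have d0 : 0 < `|x - y| by rewrite normr_gt0 subr_eq0.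
  near=> p K => /=.
  have [px py] : `|x - p.1| < e /\ `|y - p.2| < e' by near: p; exact: near2.
  have [px' py'] : `|x - p.1| < `|x - y| / 4 /\ `|y - p.2| < `|x - y| / 4.
    by near: p; apply: near2; rewrite divr_gt0.
  (* Away from the diagonal the quotient is bounded by continuity alone. *)
  have K0 : 0 <= K by near: K; exact: nbhs_pinfty_ge.
  have KC : (`|f x - f y| + L * e + L' * e') / (`|x - y| / 2) <= K.
    by near: K; apply: nbhs_pinfty_ge; rewrite num_real.
  rewrite ler_pdivrMr ?divr_gt0// in KC.
  have xx : `|x - x| < e by rewrite subrr normr0.
  have yy : `|y - y| < e' by rewrite subrr normr0.
  have := fL _ _ xx px; have := fL' _ _ yy py => fy fx.
  have fx' : L * `|x - p.1| <= L * e by rewrite ler_wpM2l// ltW.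
  have fy' : L' * `|y - p.2| <= L' * e' by rewrite ler_wpM2l// ltW.
  have h1 : `|f p.1 - f p.2| <= `|f x - f y| + `|f x - f p.1| + `|f y - f p.2|.
    rewrite [leLHS](_ : _ = `|(f x - f y) - (f x - f p.1) + (f y - f p.2)|); last first.
      by congr (`| _ |); ring.
    by rewrite (le_trans (ler_normD _ _))// lerD2r (le_trans (ler_normB _ _)).
  have h2 : `|x - y| <= `|p.1 - p.2| + `|x - p.1| + `|y - p.2|.
    rewrite [leLHS](_ : _ = `|(p.1 - p.2) + (x - p.1) - (y - p.2)|); last first.
      by congr (`| _ |); ring.
    by rewrite (le_trans (ler_normB _ _))// lerD2r (le_trans (ler_normD _ _)).
  have h3 : K * (`|x - y| / 2) <= K * `|p.1 - p.2| by rewrite ler_wpM2l//; lra.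
  lra.
move=> A [A0 AP].
exists (Num.max A 0 + 1); first by rewrite ltr_pwDr// le_max lexx orbT.
move=> x y xM yM.
have := AP (Num.max A 0 + 1) _ (x, y); apply.
  by rewrite ltr_pwDr// le_max lexx.
by split => /=; rewrite in_itv/= -ler_norml.
Unshelve. all: by end_near. Qed.

(** Replaces integration of a differential inequality: [H - g] and [H + g] have
    nonnegative derivatives, hence are nondecreasing. *)
Lemma deriv_le_diff_le (R : realType) (g g' H H' : R -> R) (T : R) :
  {within `[0, T], continuous g} -> {within `[0, T], continuous H} ->
  (forall t : R, t \in `]0, T[ -> is_derive t 1 g (g' t)) ->
  (forall t : R, t \in `]0, T[ -> is_derive t 1 H (H' t)) ->
  (forall t : R, t \in `]0, T[ -> `|g' t| <= H' t) ->
  forall s t : R, 0 <= s -> s <= t -> t <= T -> `|g t - g s| <= H t - H s.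
Proof.
move=> gc Hc dg dH gH s t s0 st tT.
have key (k : R -> R) (k' : R -> R) : {within `[0, T], continuous k} ->
    (forall t : R, t \in `]0, T[ -> is_derive t 1 k (k' t)) ->
    (forall t : R, t \in `]0, T[ -> k' t <= H' t) -> k t - k s <= H t - H s.
  move=> kc dk kH.
  suff : H s - k s <= H t - k t by lra.
  apply: (@ger0_derive1_le_cc _ (fun t => H t - k t) 0 T) => //.
  - by move=> x x0T; have ? := dk x x0T; have ? := dH x x0T; exact: derivableB.
  - move=> x x0T; have ? := dk x x0T; have ? := dH x x0T.
    by rewrite derive1E derive_val subr_ge0 kH.
  - by move=> x; apply: continuousB; [exact: Hc|exact: kc].
  - by rewrite in_itv/= s0 (le_trans st).
  - by rewrite in_itv/= tT (le_trans s0).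
have kN : - g t - - g s <= H t - H s.
  apply: (key (fun u => - g u) (fun t => - g' t)).
  - by move=> x; apply: continuousN; exact: gc.
  - by move=> x x0T; have ? := dg x x0T; exact: is_deriveN.
  - by move=> x x0T; rewrite (le_trans _ (gH x x0T))// -normrN ler_norm.
have kP : g t - g s <= H t - H s.
  by apply: (key g g') => // x x0T; rewrite (le_trans _ (gH x x0T))// ler_norm.
by rewrite ler_norml; apply/andP; split; lra.
Qed.

Lemma ler_of_geometric (R : realType) (x y c : R) :
  (forall n, x <= y + c / 2 ^+ n) -> x <= y.
Proof.
move=> xy; apply/ler_addgt0Pr => e e0.
have /cvgrPdist_lt/(_ e e0) : @geometric R c 2^-1 @ \oo --> (0 : R).
  by apply: cvg_geometric; rewrite ger0_norm//; lra.
move=> [n _ /(_ n (leqnn n))]; rewrite /geometric/= sub0r normrN exprVn => cn.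
by rewrite (le_trans (xy n))// lerD2l (le_trans (ler_norm _))// ltW.
Qed.

Lemma halving_step (R : realType) (c : R) n :
  c / 2 ^+ n = c / 2 ^+ n.+1 + c / 2 ^+ n.+1.
Proof.
have ? : (2 : R) ^+ n != 0 by rewrite expf_neq0.
by rewrite exprS; field.
Qed.

(** The intervals of radius [c / 2 ^+ n] around [a n] are nested, so the
    supremum of their lower ends lies in all of them; this gives the limit
    together with its rate. *)
Lemma geometric_cauchy (R : realType) (a : nat -> R) (c : R) :
  (forall n, `|a n.+1 - a n| <= c / 2 ^+ n.+1) ->
  exists l, forall n, `|l - a n| <= c / 2 ^+ n.
Proof.
move=> ac.
pose lo n := a n - c / 2 ^+ n; pose up n := a n + c / 2 ^+ n.
have c0 n : 0 <= c / 2 ^+ n.+1 by apply: le_trans (ac n).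
have loS n : lo n <= lo n.+1.
  by have := ac n; rewrite /lo ler_norml => /andP[]; rewrite (halving_step c n); lra.
have upS n : up n.+1 <= up n.
  by have := ac n; rewrite /up ler_norml => /andP[]; rewrite (halving_step c n); lra.
have loM m n : (m <= n)%N -> lo m <= lo n by move: m n; apply/nondecreasing_seqP.
have upM m n : (m <= n)%N -> up n <= up m by move: m n; apply/nonincreasing_seqP.
have lu m n : lo m <= up n.
  apply: le_trans (loM _ _ (leq_maxl m n)) (le_trans _ (upM _ _ (leq_maxr m n))).
  by have := c0 (maxn m n); rewrite /lo /up (halving_step c (maxn m n)); lra.
exists (sup (range lo)) => n.
have h1 : lo n <= sup (range lo).
  by apply: ub_le_sup; [exists (up 0%N) => _ [m _ <-]|exists n].
have h2 : sup (range lo) <= up n.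
  by apply: ge_sup; [exists (lo 0%N), 0%N|move=> _ [m _ <-]].
by move: h1 h2; rewrite /lo /up ler_norml => ? ?; apply/andP; split; lra.
Qed.

Lemma continuous_within (R : realType) (g : R -> R) (A : set R) :
  (forall t, A t -> {for t, continuous g}) -> {within A, continuous g}.
Proof.
move=> gc; apply/subspace_continuousP => t At.
exact: cvg_within_filter (gc t At).
Qed.

Lemma is_derive_continuous (R : realType) (g : R -> R) (t d : R) :
  is_derive t 1 g d -> {for t, continuous g}.
Proof.
by move=> [gt _]; apply/differentiable_continuous/derivable1_diffP.
Qed.

Lemma is_derive_within (R : realType) (g g' : R -> R) (T : R) :
  (forall t : R, t \in `[0, T] -> is_derive t 1 g (g' t)) ->
  {within `[0, T], continuous g}.
Proof.
by move=> dg; apply: continuous_within => t /dg /is_derive_continuous.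
Qed.

(** The weight [expR (2 * L * t)] makes integration against the constant [L] a
    contraction of factor 1/2 on the whole of [0, T], however large [L * T] is:
    the right-hand side of the hypothesis is the derivative of
    [a * t + m / 2 * expR (2 * L * t)]. *)
Lemma bielecki_step (R : realType) (g g' : R -> R) (T a L m : R) :
  0 <= a -> 0 < L -> 0 <= m ->
  {within `[0, T], continuous g} -> g 0 = 0 ->
  (forall t : R, t \in `]0, T[ -> is_derive t 1 g (g' t)) ->
  (forall t : R, t \in `]0, T[ -> `|g' t| <= a + L * (m * expR (2 * L * t))) ->
  forall t : R, t \in `[0, T] -> `|g t| <= (a * T + m / 2) * expR (2 * L * t).
Proof.
move=> a0 L0 m0 gc g0 dg gL t; rewrite in_itv/= => /andP[t0 tT].
pose H t := a * t + m / 2 * expR (2 * L * t).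
pose H' t := a + L * (m * expR (2 * L * t)).
have dH (s : R) : is_derive s 1 H (H' s).
  rewrite /H'.
  have de : is_derive s 1 (fun x => expR (2 * L * x)) (expR (2 * L * s) * (2 * L)).
    apply: (@is_derive1_comp _ expR (fun x => 2 * L * x)).
    by apply: is_derive_eq; rewrite /GRing.scale/= mulr1.
  have -> : a + L * (m * expR (2 * L * s)) =
      a *: (1 : R) + (m / 2) *: (expR (2 * L * s) * (2 * L)).
    by rewrite /GRing.scale/=; field.
  by apply: is_deriveD; apply: is_deriveZ.
have Hc : {within `[0, T], continuous H}.
  exact: (@is_derive_within _ H H' T (fun s _ => dH s)).
have := @deriv_le_diff_le _ g g' H H' T gc Hc dg (fun t _ => dH t) gL
  0 t (lexx 0) t0 tT.
rewrite g0 subr0 /H !mulr0 expR0 add0r => /le_trans; apply.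
have e1 : 1 <= expR (2 * L * t) by rewrite -expR0 ler_expR !mulr_ge0// ltW.
have aT : a * t <= a * T by rewrite ler_wpM2l.
have aTe : a * T <= a * T * expR (2 * L * t).
  by rewrite ler_peMr// mulr_ge0// (le_trans t0).
lra.
Qed.

(** * Gronwall's inequality and Picard's theorem in the sup-norm *)

(** Each use of [bielecki_step] replaces a bound [m] on the weighted norm of [e]
    by [a * T + m / 2]. Iterating from any bound drives it to the fixed point
    [2 * a * T], which no longer depends on the initial bound. The index set is
    arbitrary: the estimate is uniform in the number of components. *)
Lemma gronwall (R : realType) (I : Type) (e d : R -> I -> R) (T a L : R) :
  0 <= a -> 0 < L ->
  (forall k, {within `[0, T], continuous (fun t => e t k)}) ->
  (forall k, e 0 k = 0) ->
  (forall (t : R) k, t \in `]0, T[ -> is_derive t 1 (fun t => e t k) (d t k)) ->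
  (exists M : R, forall (t : R) k, t \in `[0, T] -> `|e t k| <= M) ->
  (forall (t m : R), t \in `]0, T[ -> (forall k, `|e t k| <= m) ->
    forall k, `|d t k| <= a + L * m) ->
  forall (t : R) k, t \in `[0, T] ->
    `|e t k| <= 2 * a * T * expR (2 * L * T).
Proof.
move=> a0 L0 ec e0 de [M eM] dL t k tT.
have T0 : 0 <= T by move: tT; rewrite in_itv/= => /andP[]; exact: le_trans.
have aT0 : 0 <= a * T by rewrite mulr_ge0.
have step (m : R) : 0 <= m ->
    (forall (t : R) k, t \in `[0, T] -> `|e t k| <= m * expR (2 * L * t)) ->
    forall (t : R) k, t \in `[0, T] ->
      `|e t k| <= (a * T + m / 2) * expR (2 * L * t).
  move=> m0 em s j sT.
  apply: (@bielecki_step _ (fun t => e t j) (fun t => d t j)) => //.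
  move=> r rT; apply: dL => // i; apply: em.
  by move: rT; rewrite !in_itv/= => /andP[/ltW -> /ltW ->].
pose m0 := Num.max M 0.
have m00 : 0 <= m0 by rewrite le_max lexx orbT.
have iter_step n : forall (t : R) k, t \in `[0, T] ->
    `|e t k| <= (2 * (a * T) + m0 / 2 ^+ n) * expR (2 * L * t).
  elim: n => [|n IH] s j sT.
    rewrite (le_trans (eM s j sT))// expr0 divr1.
    have s0 : 0 <= s by move: sT; rewrite in_itv/= => /andP[].
    have e1 : 1 <= expR (2 * L * s) by rewrite -expR0 ler_expR !mulr_ge0// ltW.
    have : M <= m0 by rewrite le_max lexx.
    have : 2 * (a * T) + m0 <= (2 * (a * T) + m0) * expR (2 * L * s).
      by rewrite ler_peMr// addr_ge0// mulr_ge0.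
    lra.
  rewrite (_ : 2 * (a * T) + _ = a * T + (2 * (a * T) + m0 / 2 ^+ n) / 2); last first.
    by rewrite exprS; field; rewrite expf_neq0.
  apply: step IH _ _ sT.
  by rewrite addr_ge0// ?mulr_ge0// invr_ge0 exprn_ge0.
apply: (@ler_of_geometric _ _ _ (m0 * expR (2 * L * T))) => n.
apply: (le_trans (iter_step n t k tT)).
have tT' : t <= T by move: tT; rewrite in_itv/= => /andP[].
apply: (@le_trans _ _ ((2 * (a * T) + m0 / 2 ^+ n) * expR (2 * L * T))).
  rewrite ler_wpM2l// ?ler_expR ?ler_wpM2l//; last by rewrite mulr_ge0// ltW.
  by rewrite addr_ge0// ?mulr_ge0// invr_ge0 exprn_ge0.
by rewrite le_eqVlt; apply/orP; left; apply/eqP; ring.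
Qed.

(** The integral starts at -1 so that its upper end is interior to the domain of
    integration, and the derivative two-sided, also at the endpoint 0. *)
Lemma primitive (R : realType) (g : R -> R) (T : R) :
  0 <= T -> continuous g ->
  exists2 G : R -> R, G 0 = 0 &
    forall t : R, t \in `[0, T] -> is_derive t 1 G (g t).
Proof.
move=> T0 gc; pose mu := @lebesgue_measure R.
pose G (x : R) : R := (\int[mu]_(t in [set` `[-1, x]]) (g t))%R.
exists (fun x => G x - G 0) => [|t]; first exact: subrr.
rewrite in_itv/= => /andP[t0 tT].
have gi : mu.-integrable `[-1, T + 1] (EFin \o g).
  apply: continuous_compact_integrable; first exact: segment_compact.
  exact: continuous_subspaceT.
have [Gd GE] : derivable G t 1 /\ derive1 G t = g t.
  apply: (@continuous_FTC1_closed _ _ _ _ (T + 1)) => //; last exact: gc.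
  - by rewrite ltr_pwDr.
  - by rewrite (lt_le_trans _ t0).
have dG : is_derive t 1 G (g t) by rewrite -GE derive1E; exact/derivableP.
by rewrite -[g t]subr0; apply: is_deriveB.
Qed.

Lemma lipschitz_continuous (R : realType) (g : R -> R) (L : R) :
  (forall s t, `|g s - g t| <= L * `|s - t|) -> continuous g.
Proof.
move=> gL t; apply/cvgrPdist_lt => e e0.
have L0 : 0 < `|L| + 1 by rewrite ltr_pwDr.
near=> s; rewrite (le_lt_trans (gL t s))//.
apply: (@le_lt_trans _ _ ((`|L| + 1) * `|t - s|)).
  by rewrite ler_wpM2r// (le_trans (ler_norm _))// lerDl.
rewrite mulrC -ltr_pdivlMr//; near: s.
by apply: (@cvgr_dist_lt _ _ _ (nbhs t)) => //; rewrite divr_gt0.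
Unshelve. all: by end_near. Qed.

Definition clamp (R : realType) (a b s : R) : R := Num.max a (Num.min s b).

Lemma clamp_itv (R : realType) (a b s : R) : a <= b -> clamp a b s \in `[a, b].
Proof.
by move=> ab; rewrite in_itv/= /clamp le_max lexx/= ge_max ab ge_min lexx orbT.
Qed.

Lemma clamp_id (R : realType) (a b s : R) : s \in `[a, b] -> clamp a b s = s.
Proof. by rewrite in_itv/= /clamp => /andP[sa sb]; rewrite min_l// max_r. Qed.

Lemma clamp_lipschitz (R : realType) (a b s t : R) :
  `|clamp a b s - clamp a b t| <= `|s - t|.
Proof.
have maxL (c x y : R) : `|Num.max c x - Num.max c y| <= `|x - y|.
  have := ler_norm (x - y); have := ler_norm (y - x).
  rewrite (distrC y x) => ? ?; rewrite ler_norml; apply/andP.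
  by case: (leP c x) => ?; case: (leP c y) => ?; split; lra.
have minL (c x y : R) : `|Num.min x c - Num.min y c| <= `|x - y|.
  have := ler_norm (x - y); have := ler_norm (y - x).
  rewrite (distrC y x) => ? ?; rewrite ler_norml; apply/andP.
  by case: (leP x c) => ?; case: (leP y c) => ?; split; lra.
exact: le_trans (maxL _ _ _) (minL _ _ _).
Qed.

Lemma ler_dist_approx (R : realType) (x y x' y' a b : R) :
  `|x - x'| <= a -> `|y - y'| <= a -> `|x' - y'| <= b -> `|x - y| <= b + 2 * a.
Proof.
rewrite !ler_norml => /andP[? ?] /andP[? ?] /andP[? ?].
by apply/andP; split; lra.
Qed.

(** Picard iteration in the class [Lip] of functions whose components are all
    [B]-Lipschitz on [0, T]. This class is preserved because [F] is bounded by
    [B], and it makes [F \o u] continuous for any index set [I]. By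
    [bielecki_step] consecutive iterates approach each other at the rate 1/2;
    their limit is again in [Lip] and is a fixed point of the iteration. *)
Theorem picard (R : realType) (I : Type) (F : (I -> R) -> I -> R) (B L T : R)
    (x0 : I -> R) :
  0 < L -> 0 <= T -> (forall x k, `|F x k| <= B) ->
  (forall x y (m : R), (forall k, `|x k - y k| <= m) ->
    forall k, `|F x k - F y k| <= L * m) ->
  exists2 u : R -> I -> R, u 0 = x0 &
    forall (t : R) k, t \in `[0, T] -> is_derive t 1 (fun t => u t k) (F (u t) k).
Proof.
move=> L0 T0 FB FL.
have B0 (i : I) : 0 <= B by apply: le_trans (FB x0 i).
pose Lip (u : R -> I -> R) := forall (s t : R) k, s \in `[0, T] -> t \in `[0, T] ->
  `|u s k - u t k| <= B * `|s - t|.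
pose solves (u w : R -> I -> R) := w 0 = x0 /\
  forall (t : R) k, t \in `[0, T] -> is_derive t 1 (fun t => w t k) (F (u t) k).
have /choice[S SP] : forall u, exists w, Lip u -> solves u w.
  move=> u.
  have [uL|] := pselect (Lip u); last by exists u.
  (* Outside [0, T] nothing is known of u; clamping the time makes the
     integrand continuous on the whole line. *)
  have gc k : continuous (fun s => F (u (clamp 0 T s)) k).
    apply: (@lipschitz_continuous _ _ (L * B)) => s t; rewrite -mulrA.
    apply: FL => i; apply: le_trans (uL _ _ _ (clamp_itv s T0) (clamp_itv t T0)) _.
    by rewrite ler_wpM2l ?clamp_lipschitz// B0.
  have /choice[G GP] : forall k, exists G : R -> R, G 0 = 0 /\
      forall t : R, t \in `[0, T] -> is_derive t 1 G (F (u (clamp 0 T t)) k).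
    by move=> k; have [G G0 GP] := primitive T0 (gc k); exists G.
  exists (fun t k => x0 k + G k t) => _; split.
    by apply/funext => k; rewrite (GP k).1 addr0.
  move=> t k tT; have := (GP k).2 t tT; rewrite clamp_id// => dG.
  by rewrite -[F _ _]add0r; apply: is_deriveD.
have SL u : Lip u -> Lip (S u).
  move=> uL; have [_ dS] := SP u uL.
  have SLe (s t : R) k : s \in `[0, T] -> t \in `[0, T] -> s <= t ->
      `|S u t k - S u s k| <= B * `|t - s|.
    rewrite !in_itv/= => /andP[s0 _] /andP[_ tT] st.
    rewrite [`|t - s|]ger0_norm ?subr_ge0//.
    have dB (r : R) : is_derive r 1 (fun x => B * x) B.
      by apply: is_derive_eq; rewrite /GRing.scale/= mulr1.
    have h := @deriv_le_diff_le _ (fun t => S u t k) (fun r => F (u r) k)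
      (fun x => B * x) (fun=> B) T
      (@is_derive_within _ _ (fun r => F (u r) k) T (fun r => dS r k))
      (@is_derive_within _ _ (fun=> B) T (fun r _ => dB r)).
    have h1 (r : R) : r \in `]0, T[ -> is_derive r 1 (fun t => S u t k) (F (u r) k).
      move=> rT; apply: (dS _ k).
      by move: rT; rewrite !in_itv/= => /andP[/ltW -> /ltW ->].
    have h2 := h h1 (fun r _ => dB r) (fun r _ => FB (u r) k) s t s0 st tT.
    by rewrite (le_trans h2)// -mulrBr.
  move=> s t k sT tT; have [st|/ltW ts] := leP s t; last exact: SLe.
  by rewrite distrC (distrC s); exact: SLe.
have SC u w (m : R) : Lip u -> Lip w -> 0 <= m ->
    (forall (t : R) k, t \in `[0, T] -> `|u t k - w t k| <= m * expR (2 * L * t)) ->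
    forall (t : R) k, t \in `[0, T] ->
      `|S u t k - S w t k| <= m / 2 * expR (2 * L * t).
  move=> uL wL m0 uw t k tT.
  have [u0 dSu] := SP u uL; have [w0 dSw] := SP w wL.
  have dd (r : R) : r \in `[0, T] -> is_derive r 1 (fun t => S u t k - S w t k)
     (F (u r) k - F (w r) k).
    by move=> rT; have ? := dSu _ k rT; have ? := dSw _ k rT; exact: is_deriveB.
  have oc (r : R) : r \in `]0, T[ -> r \in `[0, T].
    by rewrite !in_itv/= => /andP[/ltW -> /ltW ->].
  have dc := @is_derive_within _ _ _ T dd.
  have h0 : S u 0 k - S w 0 k = 0 by rewrite u0 w0 subrr.
  have dL (r : R) : r \in `]0, T[ ->
      `|F (u r) k - F (w r) k| <= 0 + L * (m * expR (2 * L * r)).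
    by move=> rT; rewrite add0r; apply: FL => j; apply: uw; exact: oc.
  have := @bielecki_step _ _ _ T 0 L m (lexx 0) L0 m0 dc h0
    (fun r rT => dd r (oc r rT)) dL t tT.
  by rewrite mul0r add0r.
have BT0 (i : I) : 0 <= B * T by rewrite mulr_ge0// (B0 i).
have BTn (i : I) n : 0 <= B * T / 2 ^+ n.
  by rewrite mulr_ge0 ?BT0// invr_ge0 exprn_ge0.
pose u_ n := iter n S (fun=> x0).
have uL n : Lip (u_ n).
  elim: n => [s t k _ _|n IH]; last exact: SL.
  by rewrite /= subrr normr0 mulr_ge0// B0.
have e1 (t : R) : t \in `[0, T] -> 1 <= expR (2 * L * t) <= expR (2 * L * T).
  rewrite in_itv/= => /andP[t0 tT]; rewrite -{1}expR0 !ler_expR.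
  by rewrite ler_wpM2l// ?mulr_ge0// ltW.
have zT : 0 \in `[0, T] by rewrite in_itv/= lexx.
have uS n : forall (t : R) k, t \in `[0, T] ->
    `|u_ n.+1 t k - u_ n t k| <= B * T / 2 ^+ n * expR (2 * L * t).
  elim: n => [|n IH] t k tT.
    have := uL 1%N t 0 k tT zT; rewrite /u_/= (SP _ (uL 0%N)).1 subr0 => /le_trans; apply.
    move: (tT); rewrite in_itv/= => /andP[t0 tT']; rewrite [`|t|]ger0_norm// expr0 divr1.
    apply: (@le_trans _ _ (B * T)); first by rewrite ler_wpM2l// (B0 k).
    by rewrite ler_peMr ?(BT0 k)//; have /andP[] := e1 t tT.
  rewrite exprSr invfM mulrA.
  exact: SC (BTn k n) IH _ _ tT.
pose E := expR (2 * L * T); pose c := 2 * (B * T) * E.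
have /choice[u uP] : forall t : R, exists u : I -> R, t \in `[0, T] ->
    forall k n, `|u k - u_ n t k| <= c / 2 ^+ n.
  move=> t; have [tT|] := boolP (t \in `[0, T]); last by exists x0.
  have /choice[u uP] : forall k, exists l, forall n, `|l - u_ n t k| <= c / 2 ^+ n.
    move=> k; apply: (@geometric_cauchy _ (fun n => u_ n t k)) => n.
    apply: le_trans (uS n t k tT) _.
    rewrite /c exprS (_ : _ / (2 * _) = B * T / 2 ^+ n * E); last first.
      by field; rewrite expf_neq0.
    by rewrite ler_wpM2l ?(BTn k)//; have /andP[] := e1 t tT.
  by exists u.
have uLip : Lip u.
  move=> s t k sT tT; apply: (@ler_of_geometric _ _ _ (2 * c)) => n.
  rewrite -mulrA.
  exact: ler_dist_approx (uP s sT k n) (uP t tT k n) (uL n s t k sT tT).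
have Suu (t : R) : t \in `[0, T] -> S u t = u t.
  move=> tT; apply/funext => k; apply/eqP; rewrite -subr_eq0 -normr_le0.
  have c0 : 0 <= c by rewrite mulr_ge0 ?expR_ge0// mulr_ge0// (BT0 k).
  apply: (@ler_of_geometric _ _ _ (c * E + c)) => n; rewrite add0r.
  have cn : 0 <= c / 2 ^+ n by rewrite divr_ge0// exprn_ge0.
  have h : `|S u t k - S (u_ n) t k| <= c / 2 ^+ n / 2 * expR (2 * L * t).
    apply: SC => // s j sT; apply: le_trans (uP s sT j n) _.
    by rewrite ler_peMr//; have /andP[] := e1 s sT.
  have h2 : `|S u t k - S (u_ n) t k| <= c / 2 ^+ n * E.
    apply: le_trans h _; apply: ler_pM => //; first exact: divr_ge0.
      by rewrite ler_pdivrMr// ler_peMr// ler1n.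
    by have /andP[] := e1 t tT.
  have h3 : `|u t k - u_ n.+1 t k| <= c / 2 ^+ n.
    apply: le_trans (uP t tT k n.+1) _.
    by rewrite [leRHS]halving_step lerDl exprS invfM mulrCA mulr_ge0.
  rewrite mulrDl -mulrAC (le_trans (ler_distD (S (u_ n) t k) _ _))// lerD//.
  by rewrite distrC.
exists (S u); first exact: (SP u uLip).1.
by move=> t k tT; rewrite Suu//; exact: (SP u uLip).2.
Qed.

(** * Sums over the integers and summability of the grid values *)

Lemma esum_tail (R : realType) (b : int -> R) (s : seq int) (M : R) :
  (forall j, 0 <= b j) -> uniq s ->
  (forall r : seq int, uniq r -> {in r, forall j, j \notin s} ->
    \sum_(j <- r) b j <= M) ->
  exists2 x, 0 <= x <= M &
    \esum_(j in [set: int]) (b j)%:E = (\sum_(j <- s) b j + x)%:E.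
Proof.
move=> b0 us bM.
have be0 j : (0 <= (b j)%:E)%E by rewrite lee_fin.
rewrite (esumID [set` s])//= !setTI.
have -> : \esum_(j in [set` s]) (b j)%:E = (\sum_(j <- s) b j)%:E.
  by rewrite esum_fset//= -fsbig_seq// sumEFin.
have tailM : (\esum_(j in ~` [set` s]) (b j)%:E <= M%:E)%E.
  apply: ge_ereal_sup => _ [A [finA As] <-].
  rewrite fsbig_finite// sumEFin lee_fin; apply: bM => [|j].
    exact: finmap.fset_uniq.
  by rewrite in_fset_set// inE => /As/= /negP.
have tail0 : (0 <= \esum_(j in ~` [set` s]) (b j)%:E)%E by exact: esum_ge0.
have finT : \esum_(j in ~` [set` s]) (b j)%:E \is a fin_num.
  by rewrite ge0_fin_numE// (le_lt_trans tailM)// ltry.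
exists (fine (\esum_(j in ~` [set` s]) (b j)%:E)).
  by rewrite fine_ge0//= -lee_fin fineK.
by rewrite EFinD fineK.
Qed.

(** A sum over the integers is approximated by its part over [s] up to any bound
    on the finite absolute sums that avoid [s]. The bound also makes the family
    summable, which is what gives the value of [zsum] its meaning. *)
Lemma zsum_tail (R : realType) (a : int -> R) (s : seq int) (M : R) :
  uniq s ->
  (forall r : seq int, uniq r -> {in r, forall j, j \notin s} ->
    \sum_(j <- r) `|a j| <= M) ->
  `|zsum a - \sum_(j <- s) a j| <= M.
Proof.
move=> us aM.
pose p j := Num.max (a j) 0; pose n j := Num.max (- a j) 0.
have p0 j : 0 <= p j by rewrite le_max lexx orbT.
have n0 j : 0 <= n j by rewrite le_max lexx orbT.
have bound (b : int -> R) : (forall j, b j <= `|a j|) ->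
    forall r : seq int, uniq r -> {in r, forall j, j \notin s} ->
      \sum_(j <- r) b j <= M.
  by move=> ba r ur rs; apply: le_trans (aM r ur rs); apply: ler_sum.
have pa j : p j <= `|a j| by rewrite ge_max ler_norm normr_ge0.
have na j : n j <= `|a j| by rewrite ge_max -normrN ler_norm normr_ge0.
have [x /andP[x0 xM] px] := esum_tail p0 us (bound _ pa).
have [y /andP[y0 yM] ny] := esum_tail n0 us (bound _ na).
have -> : zsum a = (\sum_(j <- s) p j + x) - (\sum_(j <- s) n j + y).
  rewrite /zsum (_ : \esum_(j in _) _ = \esum_(j in [set: int]) (p j)%:E); last first.
    by apply: eq_esum => j _; rewrite funeposE/= EFin_max.
  rewrite (_ : \esum_(j in _) (_^\- j)%E = \esum_(j in [set: int]) (n j)%:E); last first.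
    by apply: eq_esum => j _; rewrite funenegE/= EFin_max EFinN.
  by rewrite px ny.
have -> : \sum_(j <- s) a j = \sum_(j <- s) p j - \sum_(j <- s) n j.
  rewrite -sumrB; apply: eq_bigr => j _; rewrite /p /n.
  by case: (leP (a j) 0) => a0; case: (leP (- a j) 0) => ?; lra.
rewrite (_ : _ - _ = x - y); last by ring.
by rewrite ler_norml; apply/andP; split; lra.
Qed.

Section grid_summable.
Context {R : realType}.
Variables (beta : R -> R) (mu : {charge set (measurableTypeR R) -> \bar R}).
Variable h : R.
Hypothesis beta_int : (@lebesgue_measure R).-integrable [set: R] (EFin \o beta).
Hypothesis betaE : forall x : R, (beta x)%:E = mu `]-oo, x]%classic.
Hypothesis h0 : 0 < h.

(** The half-open cells that end at the grid points partition the line. *)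
Let cell (j : int) : set R := `]((j - 1)%:~R * h), (j%:~R * h)].

Let cell_measurable j : measurable (cell j : set (measurableTypeR R)).
Proof. exact: measurable_itv. Qed.

Let cell_disjoint (D : set int) : trivIset D cell.
Proof.
move=> i j _ _ [x []]; rewrite /cell/= !in_itv/= => /andP[ix xi] /andP[jx xj].
have ij : (i - 1 < j)%R by rewrite -(ltr_int R) -(ltr_pM2r h0) (lt_le_trans ix).
have ji : (j - 1 < i)%R by rewrite -(ltr_int R) -(ltr_pM2r h0) (lt_le_trans jx).
by lia.
Qed.

(** On the cell that ends at a grid point, [beta] differs from its value at the
    grid point by at most the variation of [mu] over the cell. Integrating over
    the cell and summing, [h] times the sum is at most the L1 norm of [beta]
    plus [h] times the total variation of [mu]. *)
Lemma grid_values_summable : exists S : R, forall s : seq int, uniq s ->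
  \sum_(j <- s) `|grid_values h beta j| <= S.
Proof.
have [P [N PN]] := Hahn_decomposition mu.
pose nu := charge_variation PN.
pose leb := @lebesgue_measure R.
have mbeta : measurable_fun [set: R] (abse \o (EFin \o beta) : R -> \bar R).
  by apply: measurableT_comp => //; case/integrableP: beta_int.
have nu_fin A : measurable A -> nu A \is a fin_num.
  exact: fin_num_measure.
have osc j x : cell j x -> (`|(beta (j%:~R * h))%:E| <= `|(beta x)%:E| + nu (cell j))%E.
  rewrite /cell/= in_itv/= => /andP[]; set y := j%:~R * h => jx xj.
  have m1 : measurable (`]-oo, x] : set (measurableTypeR R)) by exact: measurable_itv.
  have m2 : measurable (`]x, y] : set (measurableTypeR R)) by exact: measurable_itv.
  rewrite -!abse_EFin; have -> : (beta y)%:E = ((beta x)%:E + mu `]x, y]%classic)%E.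
    rewrite !betaE -chargeU//; first by rewrite -itv_bndbnd_setU.
    rewrite -subset0 => z [] /=; rewrite !in_itv/= => zx.
    by move=> /andP[/lt_le_trans/(_ zx)]; rewrite ltxx.
  apply: le_trans (lee_abs_add _ _) _; rewrite leeD2l//.
  apply: le_trans (abse_charge_variation PN m2) _.
  apply: le_measure; rewrite ?inE//.
  by move=> z /=; rewrite !in_itv/= => /andP[/(lt_trans jx) -> ->].
have step j : (h%:E * `|(grid_values h beta j)%:E| <=
    \int[leb]_(x in cell j) `|(beta x)%:E| + h%:E * nu (cell j))%E.
  have leb_cell : leb (cell j) = h%:E.
    rewrite /leb lebesgue_measure_itv/= lte_fin ltr_pM2r// ltr_int ltrBlDr ltrDl ltr01.
    by rewrite -EFinD; congr EFin; rewrite intrB; ring.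
  rewrite -leb_cell muleC -(integral_cst leb (cell_measurable j)).
  rewrite [X in (_ + X)%E]muleC -(integral_cst leb (cell_measurable j)).
  rewrite -ge0_integralD//=; last first.
    exact: measurable_funTS.
  apply: ge0_le_integral => //=; last by move=> x jx; exact: osc.
  by apply: emeasurable_funD => //; exact: measurable_funTS.
exists (fine (\int[leb]_x `|(beta x)%:E| + h%:E * nu setT)%E / h).
move=> s us; rewrite ler_pdivlMr// -lee_fin fineK; last first.
  rewrite fin_numD fin_numM ?nu_fin// andbT ge0_fin_numE ?integral_ge0//.
  by case/integrableP: beta_int.
rewrite mulrC mulr_sumr -sumEFin.
apply: (@le_trans _ _ (\sum_(j <- s)
    (\int[leb]_(x in cell j) `|(beta x)%:E| + h%:E * nu (cell j)))%E).
  by apply: lee_sum => j _; rewrite EFinM; exact: step.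
rewrite big_split/= leeD//.
  rewrite -ge0_integral_bigsetU//=; last exact: measurable_funTS.
  by apply: ge0_subset_integral => //; apply: bigsetU_measurable.
rewrite -ge0_sume_distrr//; apply: lee_wpmul2l; first by rewrite lee_fin ltW.
rewrite fsbig_seq// /nu -measure_fin_bigcup//.
by apply: le_measure; rewrite ?inE//; exact: fin_bigcup_measurable.
Qed.

End grid_summable.

(** * Derivatives on a segment *)

Section derive_on_theory.
Context {R : realType}.

Lemma within_cvgP (V : normedModType R) (A : set R) (q : R -> V) (t : R) (l : V) :
  q s @[s --> within A t^'] --> l <->
  forall e, 0 < e -> exists2 r : R, 0 < r &
    forall s, A s -> s != t -> `|t - s| < r -> `|l - q s| < e.
Proof.
split=> [/cvgrPdist_lt ql e e0|ql].
  have /nbhs_ballP[r /= r0 qr] := ql e e0; exists r => // s As st tsr.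
  exact: qr.
apply/cvgrPdist_lt => e e0; have [r r0 qr] := ql e e0.
by apply/nbhs_ballP; exists r => //= s ts st As; exact: qr.
Qed.

(** Coordinates of sequences and of row vectors are the linear functionals [p] of
    norm at most 1 that this is applied to. *)
Lemma derivable_on_coord (V : normedModType R) (p : V -> R) (A : set R)
    (g : R -> V) (t : R) :
  (forall x y, p (x - y) = p x - p y) -> (forall a x, p (a *: x) = a * p x) ->
  (forall x, `|p x| <= `|x|) -> derivable_on A g t ->
  (s - t)^-1 *: (p (g s) - p (g t)) @[s --> within A t^'] --> p (derive_on A g t).
Proof.
move=> pB pZ pN /within_cvgP gt; apply/within_cvgP => e e0.
have [r r0 gr] := gt e e0; exists r => // s As st ts.
by apply: le_lt_trans (gr s As st ts); rewrite -pB -[_ *: _]pZ -pB pN.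
Qed.

Lemma derivable_on_cvg_continuous (V : normedModType R) (A : set R)
    (g : R -> V) :
  (forall t, A t -> derivable_on A g t) -> {within A, continuous g}.
Proof.
move=> gd; apply/subspace_continuousP => t At.
have /within_cvgP/(_ 1 ltr01)[r r0 gr] := gd t At.
set l := lim _ in gr.
have l1 : 0 < `|l| + 1 by rewrite ltr_pwDr.
apply/cvgrPdist_lt => e e0.
apply/nbhs_ballP; exists (Num.min r (e / (`|l| + 1))).
  by rewrite /= lt_min r0 divr_gt0.
move=> s /= ts As; have [->|st] := eqVneq s t; first by rewrite subrr normr0.
move: ts; rewrite /ball/= lt_min => /andP[tsr tse].
have := gr s As st tsr; set q := _ *: _ => lq.
have gE : g t - g s = - ((s - t) *: q).
  by rewrite /q scalerA divff ?subr_eq0// scale1r opprB.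
have ql : `|q| <= `|l| + 1.
  rewrite -[q](subrK l) (le_trans (ler_normD _ _))// addrC lerD2l.
  by rewrite distrC ltW.
rewrite gE normrN normrZ distrC (le_lt_trans (ler_wpM2l _ ql))//.
by rewrite -ltr_pdivlMr.
Qed.

Lemma continuous_within_bounded (V : normedModType R) (a b : R) (g : R -> V) :
  {within `[a, b], continuous g} ->
  exists2 M : R, 0 <= M & forall t : R, t \in `[a, b] -> `|g t| <= M.
Proof.
move=> gc.
have /compact_bounded/pinfty_ex_gt0[M M0 gM] :
  compact (g @` `[a, b]) by apply: continuous_compact => //; exact: segment_compact.
by exists M; [exact: ltW|move=> t tab; apply: gM; exists t].
Qed.

Lemma derive_on_interior (g : R -> R) (a b t l : R) : t \in `]a, b[ ->
  (s - t)^-1 *: (g s - g t) @[s --> within `[a, b] t^'] --> l ->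
  is_derive t 1 g l.
Proof.
rewrite in_itv/= => /andP[at_ tb] /within_cvgP gl.
have gl' : (fun h : R => h^-1 *: ((g \o shift t) (h *: 1) - g t)) @ 0^' --> l.
  apply/cvgrPdist_lt => e e0; have [r r0 gr] := gl e e0.
  apply/nbhs_ballP; exists (Num.min r (Num.min (t - a) (b - t))).
    by rewrite /= !lt_min r0 !subr_gt0 at_.
  move=> s; rewrite /ball/= sub0r normrN !lt_min => /and3P[sr sa sb] s0.
  have := gr (s + t); rewrite addrK /GRing.scale/= mulr1; apply.
  - rewrite in_itv/=; move: sa sb; rewrite !ltr_norml => /andP[? ?] /andP[? ?].
    by apply/andP; split; lra.
  - by rewrite -subr_eq0 addrK.
  - by rewrite opprD addrCA subrr addr0 normrN.
split; first by apply/cvg_ex; exists l.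
exact: cvg_lim gl'.
Qed.

Lemma is_derive_within_cvg (g : R -> R) (A : set R) (t l : R) :
  is_derive t 1 g l ->
  (s - t)^-1 *: (g s - g t) @[s --> within A t^'] --> l.
Proof.
move=> [gd <-]; apply/within_cvgP => e e0.
have /cvgrPdist_lt/(_ e e0)/nbhs_ballP[r /= r0 gr] := gd.
exists r => // s As st ts.
have := gr (s - t); rewrite /ball/= sub0r normrN distrC => /(_ ts).
by rewrite subr_eq0 => /(_ st); rewrite /GRing.scale/= mulr1 subrK.
Qed.

(** The limits that define [derive_on] are unique only when the times involved
    accumulate at [t], which needs an interval of positive length. *)
Lemma within_itv_proper (T t : R) : 0 < T -> t \in `[0, T] ->
  ProperFilter (within `[0, T] t^').
Proof.
move=> T0; rewrite in_itv/= => /andP[t0 tT].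
apply: Build_ProperFilter_ex => P /nbhs_ballP[r /= r0 Pr].
pose d := Num.min (r / 2) (T / 2).
have d0 : 0 < d by rewrite lt_min !divr_gt0.
have dr : d < r by rewrite gt_min ltr_pdivrMr// ltr_pMr// ltr1n.
have dT : d <= T / 2 by rewrite ge_min lexx orbT.
have [tT2|tT2] := leP t (T / 2).
  exists (t + d); apply: Pr.
  - by rewrite /ball/= opprD addNKr normrN gtr0_norm.
  - by rewrite -subr_eq0 addrC addKr gt_eqF.
  - by rewrite /= in_itv/=; apply/andP; split; lra.
exists (t - d); apply: Pr.
- by rewrite /ball/= opprB addrCA subrr addr0 gtr0_norm.
- by rewrite -subr_eq0 addrC addKr oppr_eq0 gt_eqF.
- by rewrite /= in_itv/=; apply/andP; split; lra.
Qed.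

Lemma derive_on_row (n : nat) (w : R -> 'I_n.+1 -> R) (T t : R)
    (l : 'rV[R]_n.+1) : 0 < T -> t \in `[0, T] ->
  (forall k, is_derive t 1 (fun s => w s k) (l 0 k)) ->
  derivable_on `[0, T] (fun s => \row_k w s k) t /\
  derive_on `[0, T] (fun s => \row_k w s k) t = l.
Proof.
move=> T0 tT wl; have := within_itv_proper T0 tT => PF.
have qc : (s - t)^-1 *: (\row_k w s k - \row_k w t k)
    @[s --> within `[0, T] t^'] --> l.
  apply/cvgrPdist_lt => e e0.
  have : \forall s \near within `[0, T] t^', forall k,
      `|l 0 k - (s - t)^-1 *: (w s k - w t k)| < e.
    apply: filter_forall => k.
    by have /cvgrPdist_lt := is_derive_within_cvg `[0, T] (wl k); apply.
  apply: filterS => s le_e.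
  rewrite [ltLHS]mx_normrE; apply/bigmax_ltP; split => // -[i k] _ /=.
  by rewrite !mxE ord1; exact: le_e.
split; first by apply/cvg_ex; exists l.
exact: cvg_lim qc.
Qed.

End derive_on_theory.

(** * The truncated field *)

Lemma derivable_on_coordP (R : realType) (V : normedModType R) (p : V -> R)
    (a b : R) (g : R -> V) :
  (forall x y, p (x - y) = p x - p y) -> (forall c x, p (c *: x) = c * p x) ->
  (forall x, `|p x| <= `|x|) ->
  (forall t : R, t \in `[a, b] -> derivable_on `[a, b] g t) ->
  {within `[a, b], continuous (fun t => p (g t))} /\
  forall t : R, t \in `]a, b[ ->
    is_derive t 1 (fun t => p (g t)) (p (derive_on `[a, b] g t)).
Proof.
move=> pB pZ pN gd; split.
  apply: derivable_on_cvg_continuous => t tab; apply/cvg_ex.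
  exists (p (derive_on `[a, b] g t)).
  exact: (derivable_on_coord pB pZ pN (gd t tab)).
move=> t tab; apply: (derive_on_interior tab).
apply: (derivable_on_coord pB pZ pN); apply: gd.
by move: tab; rewrite !in_itv/= => /andP[/ltW -> /ltW ->].
Qed.

Lemma ler_coord_norm (R : realType) (n : nat) (u : 'rV[R]_n) k :
  `|u 0 k| <= `|u|.
Proof.
rewrite [leRHS]mx_normrE; exact: (le_bigmax _ (fun ij => `|u ij.1 ij.2|) (0, k)).
Qed.

Section lattice_theory.
Context {R : realType}.
Variables (beta : R -> R) (h S : R).
Hypothesis h0 : 0 < h.
Hypothesis betaS : forall s : seq int, uniq s ->
  \sum_(j <- s) `|grid_values h beta j| <= S.

Let b := grid_values h beta.

Lemma grid_sum_ge0 : 0 <= S.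
Proof. by have := betaS (isT : uniq [::]); rewrite big_nil. Qed.

Lemma grid_shift_sum (s : seq int) (i : int) : uniq s ->
  \sum_(j <- s) `|b (i - j)| <= S.
Proof.
move=> us; rewrite -(big_map (fun j => i - j) xpredT (fun j => `|b j|)).
by apply: betaS; rewrite map_inj_uniq// => x y /addrI /oppr_inj.
Qed.

Lemma kernelE (i : int) :
  h * cdiff h b i = 2^-1 * b (i + 1) - 2^-1 * b (i - 1).
Proof. by rewrite /cdiff; field; rewrite gt_eqF. Qed.

(** The kernel of the truncated system is dominated by two shifted copies of the
    grid values with weight 1/2, whence a row-sum bound that does not depend on
    the truncation. *)
Lemma kernel_sum (s : seq int) (i : int) : uniq s ->
  \sum_(j <- s) `|h * cdiff h b (i - j)| <= S.
Proof.
move=> us; have S1 := grid_shift_sum (i + 1) us; have S2 := grid_shift_sum (i - 1) us.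
apply: (@le_trans _ _ (\sum_(j <- s)
    (2^-1 * `|b (i + 1 - j)| + 2^-1 * `|b (i - 1 - j)|))).
  apply: ler_sum => j _; rewrite kernelE.
  have half : `|2^-1 : R| = 2^-1 by rewrite ger0_norm// invr_ge0.
  apply: le_trans (ler_normB _ _) _.
  by rewrite !normrM half (addrAC i _ 1) (addrAC i _ (- 1)).
by rewrite big_split/= -!mulr_sumr; lra.
Qed.

Lemma cdiff_conv_tail (z : int -> R) (s : seq int) (e : R) (i : int) :
  uniq s -> 0 <= e -> (forall j, j \notin s -> `|z j| <= e) ->
  `|cdiff h (Defs.conv h b z) i - \sum_(j <- s) h * cdiff h b (i - j) * z j| <= S * e.
Proof.
move=> us e0 ze.
have tail i' : `|Defs.conv h b z i' - \sum_(j <- s) h * b (i' - j) * z j| <= h * S * e.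
  apply: zsum_tail => // r ur rs.
  apply: (@le_trans _ _ (\sum_(j <- r) (h * e) * `|b (i' - j)|)).
    rewrite big_seq [leRHS]big_seq; apply: ler_sum => j jr.
    rewrite !normrM gtr0_norm// mulrAC ler_wpM2r// ler_wpM2l ?ze ?rs//.
    exact: ltW.
  by rewrite -mulr_sumr mulrAC ler_wpM2r// ler_wpM2l ?grid_shift_sum// ltW.
have t1 := tail (i + 1); have t2 := tail (i - 1).
set c1 := Defs.conv h b z (i + 1) in t1; set c2 := Defs.conv h b z (i - 1) in t2.
set s1 := \sum_(j <- s) _ in t1; set s2 := \sum_(j <- s) _ in t2.
have -> : \sum_(j <- s) h * cdiff h b (i - j) * z j = (2 * h)^-1 * (s1 - s2).
  rewrite /s1 /s2 -sumrB mulr_sumr; apply: eq_bigr => j _.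
  rewrite kernelE !(addrAC i _ (- j)); field.
  by rewrite gt_eqF.
rewrite /cdiff -/c1 -/c2 -mulrBr normrM gtr0_norm ?invr_gt0 ?mulr_gt0//.
rewrite ler_pdivrMl ?mulr_gt0//.
rewrite (_ : _ - _ = (c1 - s1) - (c2 - s2)); last by ring.
apply: le_trans (ler_normB _ _) _.
rewrite (_ : 2 * h * (S * e) = h * S * e + h * S * e); last by ring.
exact: lerD.
Qed.

Definition trunc_support (N : nat) : seq int :=
  [seq trunc_index k | k <- enum 'I_N.*2.+1].

Lemma trunc_support_uniq N : uniq (trunc_support N).
Proof.
rewrite map_inj_uniq ?enum_uniq// => k l /addIr[]; exact: val_inj.
Qed.

Lemma mem_trunc_support N (j : int) : j \notin trunc_support N -> (N%:Z < `|j|)%R.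
Proof.
apply: contraR; rewrite -leNgt ler_norml => /andP[Nj jN].
have jN0 : 0 <= j + N%:Z by rewrite -lerBlDr sub0r.
have jN2 : (absz (j + N%:Z)%R < N.*2.+1)%N.
  by rewrite ltnS -lez_nat gez0_abs// -addnn PoszD lerD2r.
apply/mapP; exists (Ordinal jN2); first by rewrite mem_enum.
by rewrite /trunc_index/= gez0_abs// addrK.
Qed.

Lemma trunc_support_sum N (F : int -> R) :
  \sum_(j <- trunc_support N) F j = \sum_(k < N.*2.+1) F (trunc_index k).
Proof. by rewrite big_map big_enum. Qed.

(** Comparing two nonlinearities at once serves for the boundedness of the
    truncated field ([g] constantly zero), for its Lipschitz continuity ([f] and
    [g] equal), and for the change from [f] to its clamped version. *)
Lemma trunc_rhs_dist N (f g : R -> R) (u w : 'rV[R]_N.*2.+1) (A : R) k :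
  (forall l, `|f (u 0 l) - g (w 0 l)| <= A) ->
  `|trunc_rhs h beta f u 0 k - trunc_rhs h beta g w 0 k| <= S * A.
Proof.
move=> fg; have A0 : 0 <= A by apply: le_trans (fg k).
have -> : trunc_rhs h beta f u 0 k - trunc_rhs h beta g w 0 k =
    \sum_(l < N.*2.+1) h * cdiff h b (trunc_index k - trunc_index l) *
      (g (w 0 l) - f (u 0 l)).
  rewrite !mxE opprK addrC -sumrB; apply: eq_bigr => l _; exact/esym/mulrBr.
apply: (le_trans (ler_norm_sum _ _ _)).
apply: (@le_trans _ _ (\sum_(l < N.*2.+1)
    `|h * cdiff h b (trunc_index k - trunc_index l)| * A)).
  by apply: ler_sum => l _; rewrite normrM distrC ler_wpM2l.
rewrite -mulr_suml ler_wpM2r//.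
have := kernel_sum (trunc_index k) (trunc_support_uniq N).
by rewrite trunc_support_sum.
Qed.

(** The defect with which the truncation of a sequence satisfies the truncated
    equation consists of the omitted terms only, where [f \o z] is small. *)
Lemma trunc_defect N (f : R -> R) (z : int -> R) (e : R) (k : 'I_N.*2.+1) :
  0 <= e -> (forall j, (N%:Z < `|j|)%R -> `|f (z j)| <= e) ->
  `|trunc_rhs h beta f (trunc N z) 0 k
    + cdiff h (Defs.conv h b (f \o z)) (trunc_index k)| <= S * e.
Proof.
move=> e0 fe; rewrite addrC.
have := @cdiff_conv_tail (f \o z) _ e (trunc_index k) (trunc_support_uniq N) e0
  (fun j js => fe j (mem_trunc_support js)).
rewrite trunc_support_sum mxE.
by under [in X in _ -> is_true (`|_ + X| <= _)]eq_bigr do rewrite mxE.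
Qed.

End lattice_theory.

Lemma epsilon_ub (R : realType) (f : R -> R) (d z : R) :
  locally_lipschitz f -> `|z| <= d -> `|f z| <= epsilon f d.
Proof.
move=> fl zd; apply: ub_le_sup; last by exists z.
have [L L0 fL] := locally_lipschitz_segment d fl.
have d0 : 0 <= d by apply: le_trans zd.
exists (`|f 0| + L * d) => _ [y /= yd <-].
rewrite -[f y](subrK (f 0)) addrC (le_trans (ler_normD _ _))// lerD2l.
by apply: le_trans (fL _ _ yd _) _; rewrite ?normr0// subr0 ler_wpM2l// ltW.
Qed.

Lemma delta_ub (R : realType) (T M : R) (v : R -> linf R) (N : nat) (t : R)
    (i : int) :
  (forall (s : R) j, s \in `[0, T] -> `|v s j| <= M) -> t \in `[0, T] ->
  (N%:Z < `|i|)%R -> `|v t i| <= delta T v N.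
Proof.
move=> vM tT Ni; apply: ub_le_sup; last by exists t, i.
by exists M => _ [s [j [sT _ ->]]]; exact: vM.
Qed.

(** * Comparison of the two systems *)

Lemma trunc_solution_coord (R : realType) (beta f : R -> R) (h T : R) (N : nat)
    (u0 : 'rV[R]_N.*2.+1) (u : R -> 'rV[R]_N.*2.+1) (k : 'I_N.*2.+1) :
  trunc_solution h beta f T u0 u ->
  {within `[0, T], continuous (fun t => u t 0 k)} /\
  forall t : R, t \in `]0, T[ ->
    is_derive t 1 (fun t => u t 0 k) (trunc_rhs h beta f (u t) 0 k).
Proof.
move=> [_ du].
have [||||uc ud] := @derivable_on_coordP R _ (fun x : 'rV[R]_N.*2.+1 => x 0 k) 0 T u.
- by move=> x y; rewrite !mxE.
- by move=> c x; rewrite !mxE.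
- by move=> x; exact: ler_coord_norm.
- by move=> t tT; have [] := du t tT.
split=> // t tT; have tT' : t \in `[0, T].
  by move: tT; rewrite !in_itv/= => /andP[/ltW -> /ltW ->].
by have [_ <-] := du t tT'; exact: ud.
Qed.

Lemma trunc_solution_bounded (R : realType) (beta f : R -> R) (h T : R) (N : nat)
    (u0 : 'rV[R]_N.*2.+1) (u : R -> 'rV[R]_N.*2.+1) :
  trunc_solution h beta f T u0 u ->
  exists2 M : R, 0 <= M & forall (t : R) k, t \in `[0, T] -> `|u t 0 k| <= M.
Proof.
move=> [_ du].
have uc : {within `[0, T], continuous u}.
  by apply: derivable_on_cvg_continuous => t tT; have [] := du t tT.
have [M M0 uM] := continuous_within_bounded uc.
by exists M => // t k tT; apply: le_trans (uM t tT); exact: ler_coord_norm.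
Qed.

Lemma lattice_solution_coord (R : realType) (beta f : R -> R) (h T : R)
    (v : R -> linf R) (i : int) : lattice_solution h beta f T v ->
  {within `[0, T], continuous (fun t => v t i : R)} /\
  forall t : R, t \in `]0, T[ -> is_derive t 1 (fun t => v t i : R)
    (- cdiff h (Defs.conv h (grid_values h beta) (f \o v t)) i).
Proof.
move=> [[dv _] v_eq].
have [||||vc vd] := @derivable_on_coordP R _ (fun w : linf R => w i : R) 0 T v.
- by [].
- by [].
- by move=> w; exact: linf_norm_ub.
- by move=> t tT; exact: dv.
split=> // t tT; have tT' : t \in `[0, T].
  by move: tT; rewrite !in_itv/= => /andP[/ltW -> /ltW ->].
by rewrite -(v_eq t tT' i); exact: vd.
Qed.

Lemma lattice_solution_bounded (R : realType) (beta f : R -> R) (h T : R)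
    (v : R -> linf R) : lattice_solution h beta f T v ->
  exists2 M : R, 0 <= M & forall (t : R) i, t \in `[0, T] -> `|v t i| <= M.
Proof.
move=> [[dv _] _].
have vc : {within `[0, T], continuous v}.
  by apply: derivable_on_cvg_continuous => t tT; exact: dv.
have [M M0 vM] := continuous_within_bounded vc.
by exists M => // t i tT; apply: le_trans (vM t tT); exact: linf_norm_ub.
Qed.

Section trunc_theory.
Context {R : realType}.
Variables (beta : R -> R) (h S T : R).
Hypotheses (h0 : 0 < h) (T0 : 0 < T).
Hypothesis betaS : forall s : seq int, uniq s ->
  \sum_(j <- s) `|grid_values h beta j| <= S.

Let S0 : 0 <= S := grid_sum_ge0 betaS.

(** A Lipschitz bound on any segment containing the values of both solutions
    suffices, and the two continuous solutions are bounded on [0, T]. *)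
Lemma trunc_solution_unique (f : R -> R) (N : nat) (u0 : 'rV[R]_N.*2.+1)
    (u w : R -> 'rV[R]_N.*2.+1) :
  locally_lipschitz f -> trunc_solution h beta f T u0 u ->
  trunc_solution h beta f T u0 w -> forall t : R, t \in `[0, T] -> u t = w t.
Proof.
move=> fl su sw t tT.
have [Mu Mu0 uM] := trunc_solution_bounded su.
have [Mw Mw0 wM] := trunc_solution_bounded sw.
have [L L0 fL] := locally_lipschitz_segment (Mu + Mw) fl.
pose K := S * L + 1.
have K0 : 0 < K by rewrite ltr_pwDr// mulr_ge0// ltW.
have oc (s : R) : s \in `]0, T[ -> s \in `[0, T].
  by rewrite !in_itv/= => /andP[/ltW -> /ltW ->].
apply/rowP => k; apply/eqP; rewrite -subr_eq0 -normr_le0.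
have := @gronwall R 'I_N.*2.+1 (fun s k => u s 0 k - w s 0 k)
  (fun s k => trunc_rhs h beta f (u s) 0 k - trunc_rhs h beta f (w s) 0 k)
  T 0 K (lexx 0) K0.
rewrite mulr0 !mul0r; apply => //.
- move=> j; have [uc _] := trunc_solution_coord j su.
  have [wc _] := trunc_solution_coord j sw.
  by move=> x; apply: continuousB; [exact: uc|exact: wc].
- by move=> j; rewrite su.1 sw.1 subrr.
- move=> s j sT; have [_ /(_ s sT) ud] := trunc_solution_coord j su.
  have [_ /(_ s sT) wd] := trunc_solution_coord j sw.
  exact: is_deriveB.
- exists (Mu + Mw) => s j sT.
  by rewrite (le_trans (ler_normB _ _))// lerD ?uM ?wM.
- move=> s m sT uw j; have m0 : 0 <= m by apply: le_trans (uw j).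
  rewrite add0r; apply: (@le_trans _ _ (S * (L * m))).
    apply: trunc_rhs_dist => // l; apply: le_trans (ler_wpM2l (ltW L0) (uw l)).
    apply: fL.
      by rewrite (le_trans (uM _ _ (oc s sT)))// lerDl.
    by rewrite (le_trans (wM _ _ (oc s sT)))// lerDr.
  by rewrite mulrA ler_wpM2r// lerDl.
Qed.

Lemma clamped_trunc_solution (f : R -> R) (N : nat) (u0 : 'rV[R]_N.*2.+1)
    (L B : R) : 0 < L -> (forall x, `|f x| <= B) ->
  (forall x y, `|f x - f y| <= L * `|x - y|) ->
  exists u : R -> 'rV[R]_N.*2.+1, trunc_solution h beta f T u0 u.
Proof.
move=> L0 fB fL.
pose F (x : 'I_N.*2.+1 -> R) k := trunc_rhs h beta f (\row_j x j) 0 k.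
pose K := S * L + 1.
have K0 : 0 < K by rewrite ltr_pwDr// mulr_ge0// ltW.
have FB x k : `|F x k| <= S * B.
  have rhs0 : trunc_rhs h beta (fun=> 0) (\row_j x j) 0 k = 0.
    by rewrite mxE big1 ?oppr0// => j _; rewrite mulr0.
  rewrite -[F x k]subr0 -rhs0; apply: (trunc_rhs_dist h0 betaS) => l.
  by rewrite subr0.
have FK x y (m : R) : (forall k, `|x k - y k| <= m) ->
    forall k, `|F x k - F y k| <= K * m.
  move=> xy k; have m0 : 0 <= m by apply: le_trans (xy k).
  apply: (@le_trans _ _ (S * (L * m))); last first.
    by rewrite mulrA ler_wpM2r// lerDl.
  apply: trunc_rhs_dist => // l; rewrite !mxE.
  by apply: le_trans (fL _ _) _; rewrite ler_wpM2l// ltW.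
have [w w0 dw] := picard (fun k => u0 0 k) K0 (ltW T0) FB FK.
exists (fun t => \row_k w t k); split.
  by apply/rowP => k; rewrite mxE w0.
by move=> t tT; apply: derive_on_row => // k; exact: dw.
Qed.

(** The error [u - v] satisfies a linear differential inequality with forcing
    term [S * e]. The nonlinearity [g] of the truncated system need only be
    comparable with [f] at the values of the infinite system. *)
Lemma trunc_error (f g : R -> R) (v : R -> linf R) (N : nat) (L e M : R)
    (u : R -> 'rV[R]_N.*2.+1) :
  0 < L -> 0 <= e -> (forall x y, `|y| <= M -> `|g x - f y| <= L * `|x - y|) ->
  lattice_solution h beta f T v ->
  (forall (t : R) i, t \in `[0, T] -> `|v t i| <= M) ->
  (forall (t : R) i, t \in `[0, T] -> (N%:Z < `|i|)%R -> `|f (v t i)| <= e) ->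
  trunc_solution h beta g T (trunc N (v 0)) u ->
  forall (t : R) k, t \in `[0, T] ->
    `|u t 0 k - v t (trunc_index k)| <=
      2 * (S * e) * T * expR (2 * (S * L + 1) * T).
Proof.
move=> L0 e0 fgL sv vM ve su.
have [Mu Mu0 uM] := trunc_solution_bounded su.
have oc (s : R) : s \in `]0, T[ -> s \in `[0, T].
  by rewrite !in_itv/= => /andP[/ltW -> /ltW ->].
have Se0 : 0 <= S * e by rewrite mulr_ge0.
have K0 : 0 < S * L + 1 by rewrite ltr_pwDr// mulr_ge0// ltW.
apply: (@gronwall R 'I_N.*2.+1 (fun s k => u s 0 k - v s (trunc_index k))
  (fun s k => trunc_rhs h beta g (u s) 0 k -
    - cdiff h (Defs.conv h (grid_values h beta) (f \o v s)) (trunc_index k))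
  T (S * e) (S * L + 1) Se0 K0).
- move=> j; have [uc _] := trunc_solution_coord j su.
  have [vc _] := lattice_solution_coord (trunc_index j) sv.
  by move=> x; apply: continuousB; [exact: uc|exact: vc].
- by move=> j; rewrite su.1 mxE subrr.
- move=> s j sT; have [_ /(_ s sT) ud] := trunc_solution_coord j su.
  have [_ /(_ s sT) vd] := lattice_solution_coord (trunc_index j) sv.
  exact: is_deriveB.
- exists (Mu + M) => s j sT.
  by rewrite (le_trans (ler_normB _ _))// lerD ?uM ?vM.
- move=> s m sT uv j; have m0 : 0 <= m by apply: le_trans (uv j).
  have sT' := oc s sT.
  rewrite opprK -[X in X + _](subrK (trunc_rhs h beta f (trunc N (v s)) 0 j)).
  rewrite -addrA addrC; apply: le_trans (ler_normD _ _) _; apply: lerD.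
    by apply: (trunc_defect h0 betaS) => // i; exact: ve.
  apply: (@le_trans _ _ (S * (L * m))); last first.
    by rewrite mulrA ler_wpM2r// lerDl.
  apply: (trunc_rhs_dist h0 betaS) => l.
  apply: le_trans (fgL _ _ _) _; first by rewrite mxE; exact: vM.
  by rewrite ler_wpM2l ?(ltW L0)// mxE; exact: uv.
Qed.

End trunc_theory.

Theorem theorem5p1 (R : realType) (beta f : R -> R)
    (mu : {charge set (measurableTypeR R) -> \bar R})
    (h T : R) (v : R -> linf R)
    (beta_L1 : (@lebesgue_measure R).-integrable [set: R] (EFin \o beta))
    (beta_mu : distributional_derivative beta mu)
    (betaE : forall x : R, (beta x)%:E = mu `]-oo, x]%classic)
    (f_lip : locally_lipschitz f) (f0 : f 0 = 0)
    (h_gt0 : 0 < h) (T_gt0 : 0 < T)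
    (v_sol : lattice_solution h beta f T v) :
  exists eps0 C : R, 0 < eps0 /\
    forall N : nat, (0 < N)%N ->
      let eps := epsilon f (delta T v N) in
      eps <= eps0 ->
      (exists u : R -> 'rV[R]_N.*2.+1,
         trunc_solution h beta f T (trunc N (v 0)) u) /\
      (forall u : R -> 'rV[R]_N.*2.+1,
         trunc_solution h beta f T (trunc N (v 0)) u ->
         forall t, t \in `[0, T] -> forall k : 'I_N.*2.+1,
           `|u t ord0 k - v t (trunc_index k)| <= C * eps).
Proof.
have [S betaS] := grid_values_summable beta_L1 betaE h_gt0.
have S0 := grid_sum_ge0 betaS.
have [M M0 vM] := lattice_solution_bounded v_sol.
have [L L0 fL] := locally_lipschitz_segment (M + 1) f_lip.
have M1 : 0 <= M + 1 by rewrite addr_ge0.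
(* The clamped nonlinearity is bounded and globally Lipschitz, and agrees with
   f within distance 1 of all values of the infinite system. *)
pose g (x : R) := f (clamp (- (M + 1)) (M + 1) x).
have clampM (x : R) : `|clamp (- (M + 1)) (M + 1) x| <= M + 1.
  have : clamp (- (M + 1)) (M + 1) x \in `[- (M + 1), M + 1].
    by apply: clamp_itv; lra.
  by rewrite in_itv/= ler_norml.
have gE (x : R) : `|x| <= M + 1 -> g x = f x.
  by move=> xM; rewrite /g clamp_id// in_itv/= -ler_norml.
have gL (x y : R) : `|g x - g y| <= L * `|x - y|.
  apply: le_trans (fL _ _ (clampM x) (clampM y)) _.
  by rewrite ler_wpM2l ?(ltW L0)// clamp_lipschitz.
have gB (x : R) : `|g x| <= L * (M + 1).
  have : `|f (clamp (- (M + 1)) (M + 1) x) - f 0| <=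
      L * `|clamp (- (M + 1)) (M + 1) x - 0|.
    by apply: fL => //; rewrite normr0.
  by rewrite f0 !subr0 => /le_trans; apply; rewrite ler_wpM2l ?(ltW L0).
pose C := 2 * S * T * expR (2 * (S * L + 1) * T).
have C0 : 0 <= C by rewrite !mulr_ge0 ?expR_ge0// ltW.
(* The threshold makes the error C * eps at most 1, so that the solution of the
   clamped system stays where clamping has no effect. *)
exists (C + 1)^-1, C; split; first by rewrite invr_gt0 ltr_pwDr.
move=> N N0 eps epsC.
have ve (t : R) i : t \in `[0, T] -> (N%:Z < `|i|)%R -> `|f (v t i)| <= eps.
  by move=> tT Ni; apply: epsilon_ub => //; exact: delta_ub vM tT Ni.
have zT : 0 \in `[0, T] by rewrite in_itv/= lexx ltW.
have eps0 : 0 <= eps.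
  by apply: le_trans (ve 0 N.+1%:Z zT _) => //; rewrite gtr0_norm// ltz_nat.
have Ceps : C * eps <= 1.
  apply: le_trans (ler_wpM2l C0 epsC) _.
  by rewrite ler_pdivrMr ?ltr_pwDr// mul1r lerDl.
have [w sw] := @clamped_trunc_solution R beta h S T h_gt0 T_gt0 betaS g N
  (trunc N (v 0)) L _ L0 gB gL.
have wv (t : R) k : t \in `[0, T] -> `|w t 0 k - v t (trunc_index k)| <= C * eps.
  move=> tT; have gf (x y : R) : `|y| <= M -> `|g x - f y| <= L * `|x - y|.
    by move=> yM; rewrite -(gE y)// (le_trans yM)// lerDl.
  rewrite (_ : C * eps = 2 * (S * eps) * T * expR (2 * (S * L + 1) * T)); last first.
    by rewrite /C; ring.
  exact: (trunc_error h_gt0 betaS L0 eps0 gf v_sol vM ve sw).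
have wM (t : R) k : t \in `[0, T] -> `|w t 0 k| <= M + 1.
  move=> tT; rewrite -[w t 0 k](subrK (v t (trunc_index k))) addrC.
  apply: le_trans (ler_normD _ _) _; apply: lerD; first exact: vM.
  exact: le_trans (wv t k tT) Ceps.
have swf : trunc_solution h beta f T (trunc N (v 0)) w.
  split; first exact: sw.1.
  move=> t tT; have [dw ->] := sw.2 t tT; split=> //.
  apply/rowP => k; rewrite !mxE; congr (- _); apply: eq_bigr => l _.
  by rewrite gE// wM.
split; first by exists w.
move=> u su t tT k.
rewrite (trunc_solution_unique h_gt0 betaS f_lip su swf tT).
exact: wv.
Qed.
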